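(* Let $R$ be a range set. Let $(X,d)$ be an $R$-valued ultrametric space. Then, for every fixed integer $n\in\mathbb{Z}_{\ge 1}$, the following statements are equivalent: (A1) The space $(X,d)$ is $(R,n)$-haloed. (A2) The space $(X,d)$ is $(R,n)$-avoidant. (A3) The space $(X,d)$ is $\mathscr{N}(R,n+1)$-injective. As a consequence, the following statements are equivalent: (B1) The space $(X,d)$ is $(R,\omega_0)$-haloed. (B2) The space $(X,d)$ is $(R,\omega_0)$-avoidant. (B3) The space $(X,d)$ is $\mathscr{N}(R,\omega_0)$-injective.
   Context: A range set is a subset $R\subseteq[0,\infty)$ with $0\in R$. An ultrametric is a metric $d$ with $d(x,y)\le \max\{d(x,z),d(z,y)\}$ for all $x,y,z$. An ultrametric space $(X,d)$ is $R$-valued if $d(x,y)\in R$ for all $x,y\in X$. $\omega_0$ is the set of non-negative integers, viewed as the first infinite cardinal; $\kappa\le\omega_0$ means that $\kappa$ is a non-negative integer or $\kappa=\omega_0$. $\mathrm{Card}(E)$ is the cardinality of a set $E$. For a cardinal $\kappa$, $\mathscr{N}(R,\kappa)$ is the class of all $R$-valued ultrametric spaces $(Y,e)$ with $\mathrm{Card}(Y)<\kappa$ (so $\mathscr{N}(R,\omega_0)$ is the class of all finite $R$-valued ultrametric spaces). For a class $\mathscr{C}$ of metric spaces, a metric space $(X,d)$ is $\mathscr{C}$-injective if it is non-empty and for all $(Y,e),(Z,h)\in\mathscr{C}$ and all isometric (distance-preserving) embeddings $\phi\colon Y\to Z$ and $f\colon Y\to X$ there is an isometric embedding $F\colon Z\to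 X$ with $F\circ\phi=f$. $\mathrm{B}(a,r)$ denotes the closed ball in $(X,d)$ with center $a$ and radius $r$. A subset $A\subseteq X$ is $r$-equidistant if $d(x,y)=r$ for all distinct $x,y\in A$. Let $\kappa\le\omega_0$. An ultrametric space $(X,d)$ is $(R,\kappa)$-haloed if for every $a\in X$ and every $r\in R\setminus\{0\}$ there is an $r$-equidistant subset $A$ of $\mathrm{B}(a,r)$ with $\kappa\le\mathrm{Card}(A)$. It is $(R,\kappa)$-avoidant if for every $a\in X$, every $r\in R\setminus\{0\}$ and every subset $A\subseteq\mathrm{B}(a,r)$ with $\mathrm{Card}(A)<\kappa$ there is $p\in\mathrm{B}(a,r)$ such that $d(x,p)=r$ for all $x\in A$.
   Formalization: The space X is assumed non-empty: for empty X, (A1), (A2), (B1), (B2) hold vacuously while (A3), (B3) fail, since injectivity by definition requires a non-empty space. *)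

(* Defs.v *)
From HB Require Import structures.
From mathcomp Require Import all_boot all_order all_algebra.
From mathcomp Require Import all_classical all_reals all_analysis.

Set Implicit Arguments.
Unset Strict Implicit.
Unset Printing Implicit Defensive.

Import Order.TTheory GRing.Theory Num.Theory.

Local Open Scope classical_set_scope.
Local Open Scope card_scope.
Local Open Scope ring_scope.

(* A cardinal kappa <= omega_0 is represented by a set of natural numbers of
   that cardinality: the integer n by `I_n = {0, ..., n-1}, and omega_0 by
   [set: nat]. Only the cardinality of kappa matters below. *)

Definition card_lt T U (A : set T) (B : set U) : Prop :=
  A #<= B /\ A #!= B.

Section UltrametricInjectivity.
Context {K : realType}.
Implicit Types (R : set K) (kappa : set nat) (X Y Z : metricType K) (r : K).

Definition range_set R : Prop := R `<=` [set r | 0 <= r] /\ R 0.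

Definition ultrametric X : Prop :=
  forall x y z : X, mdist x y <= Num.max (mdist x z) (mdist z y).

Definition valued R X : Prop := forall x y : X, R (mdist x y).

Definition isometric X Y (f : X -> Y) : Prop :=
  forall x y : X, mdist (f x) (f y) = mdist x y.

(* The library's closed_ball is the topological closure of the open ball, which
   in an ultrametric space is the open ball itself. *)
Definition cball X (a : X) r : set X := [set x | mdist a x <= r].

Definition equidistant X r (A : set X) : Prop :=
  forall x y : X, A x -> A y -> x <> y -> mdist x y = r.

(* N(R, kappa) *)
Definition valued_ultrametric_class R kappa Y : Prop :=
  [/\ ultrametric Y, valued R Y & card_lt [set: Y] kappa].

Definition injective_for (C : metricType K -> Prop) X : Prop :=
  [set: X] !=set0 /\
  forall Y Z, C Y -> C Z ->
  forall (phi : Y -> Z) (f : Y -> X), isometric phi -> isometric f ->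
  exists F : Z -> X, isometric F /\ F \o phi = f.

Definition haloed R kappa X : Prop :=
  forall (a : X) r, (R `\ 0) r ->
  exists A : set X, [/\ A `<=` cball a r, equidistant r A & kappa #<= A].

Definition avoidant R kappa X : Prop :=
  forall (a : X) r, (R `\ 0) r ->
  forall A : set X, A `<=` cball a r -> card_lt A kappa ->
  exists p : X, cball a r p /\ forall x, A x -> mdist x p = r.

End UltrametricInjectivity.

(* Main.v *)
(* Haloed implies avoidant by counting: if every point p of an r-equidistant
   subset H of B(a, r) has a point of A at distance < r, then choosing one for
   each p is an injection of H into A, by the ultrametric inequality.
   Avoidant implies injective by adding the points of Z one at a time.
   Injective implies n-haloed by extending a map from one point to the
   r-equidistant space with n points. For omega_0, injectivity restricts to
   every n; finite sets are then avoidable, and avoiding the points already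
   chosen builds an infinite equidistant sequence. *)

Require Import Defs.
From HB Require Import structures.
From mathcomp Require Import all_boot all_order all_algebra finmap.
From mathcomp Require Import all_classical all_reals all_analysis.

Set Implicit Arguments.
Unset Strict Implicit.
Unset Printing Implicit Defensive.

Import Order.TTheory GRing.Theory Num.Theory.

Local Open Scope classical_set_scope.
Local Open Scope card_scope.
Local Open Scope ring_scope.

(** * Cardinal comparison and finite sets *)

Lemma card_lt_finite T (A : set T) (kappa : set nat) :
  card_lt A kappa -> finite_set A.
Proof.
move=> [Ak /negP AkN]; apply: contrapT => /infiniteP natA; apply: AkN.
by apply/card_eqPle; split=> //; apply: card_le_trans (card_leT kappa) natA.
Qed.

Lemma card_lt_nat T (A : set T) : finite_set A -> card_lt A [set: nat].
Proof.
move=> Afin; split; first exact: finite_set_countable.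
by apply/negP => /eq_finite_set AE; apply: infinite_nat; rewrite -AE.
Qed.

Lemma card_ltSn T (A : set T) n : card_lt A `I_n.+1 <-> A #<= `I_n.
Proof.
split=> [ltAn|leAn]; last first.
  split; first by apply: card_le_trans leAn _; rewrite card_le_II.
  apply/negP => /card_eqPle[_ /card_le_trans/(_ leAn)].
  by rewrite card_le_II ltnn.
(* Finiteness replaces [A] by some [I_m], leaving only arithmetic: m <= n+1 and m different from n+1
   give m <= n. *)
have [m Am] := card_lt_finite ltAn; case: ltAn.
rewrite (card_le_eql Am) (card_eql Am) card_le_II leq_eqVlt.
rewrite ltnS (card_le_eql Am) card_le_II.
by move=> /orP[/eqP ->|//]; rewrite card_eqxx.
Qed.

Lemma card_lt_proper T (A B : set T) U (C : set U) :
  finite_set B -> A `<` B -> B #<= C -> card_lt A C.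
Proof.
(* [Pchoice] puts a choice structure on the arbitrary type [T], so that [fset_set] can count its
   finite subsets. *)
elim/Pchoice: T => T in A B * => Bfin [AB NBA] BC.
have Afin : finite_set A by exact: sub_finite_set Bfin.
split; first exact: card_le_trans (subset_card_le AB) BC.
apply/negP => /card_eqPle[_ CA]; apply: NBA.
have /(fcard_eq Afin Bfin) AB_card : A #= B.
  by apply/card_eqPle; split; [exact: subset_card_le|exact: card_le_trans CA].
suff -> : A = B by [].
apply: (fset_set_inj Afin Bfin); apply/eqP.
by rewrite eqEfcard AB_card leqnn andbT -fset_set_sub.
Qed.

Lemma seq_argmin (d : Order.disp_t) (V : orderType d) (T : eqType)
    (F : T -> V) x (s : seq T) :
  exists2 y, y \in x :: s & {in x :: s, forall w, (F y <= F w)%O}.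
Proof.
elim: s x => [|x' s IHs] x.
  by exists x; rewrite ?mem_head// => w /[!inE]/eqP ->.
have [y ys ymin] := IHs x'.
have [Fxy|/ltW Fyx] := leP (F x) (F y).
  exists x; first exact: mem_head.
  by move=> w /[1!inE]/predU1P[->//|/ymin]; exact: le_trans.
by exists y => [|w]; rewrite in_cons ?ys ?orbT// => /predU1P[->//|/ymin].
Qed.

(** * Haloed spaces are avoidant *)

Section UltrametricInjectivity.
Context {K : realType} (R : set K) (hR : range_set R).

Lemma range_gt0 r : (R `\ 0) r -> 0 < r.
Proof. by move=> [/(hR.1)/= r0 /eqP rN0]; rewrite lt_neqAle eq_sym rN0. Qed.

Section Space.
Variable X : metricType K.
Hypothesis X_ultrametric : ultrametric X.

Lemma haloed_avoidant (kappa : set nat) :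
  haloed R kappa X -> avoidant R kappa X.
Proof.
move=> halo a r Rr A Aball [Ak /negP NAk]; apply: contrapT => Nex.
have [H [Hball Heq kH]] := halo a _ Rr.
(* With [H p] under the existential, [choice] returns a total [f]; off [H] the value [p] is a
   dummy. *)
have near p : exists x, H p -> A x /\ mdist x p < r.
  have [Hp|NHp] := pselect (H p); last by exists p.
  apply: contrapT => /forallNP far; apply: Nex; exists p; split; first exact: Hball.
  move=> x Ax; apply/eqP; rewrite eq_le; apply/andP; split.
    apply: le_trans (X_ultrametric _ _ a) _.
    by rewrite ge_max (metric_sym x a) Aball//=; apply: Hball.
  by rewrite leNgt; apply/negP => xp; apply: (far x).
have [f fP] := choice near.
apply: NAk; apply/card_eqPle; split=> //; apply: card_le_trans kH _.
have finj : {in H &, injective f}.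
  move=> p q /set_mem Hp /set_mem Hq fpq; apply: contrapT => pq.
  have [_ fpr] := fP p Hp; have [_ fqr] := fP q Hq.
  have := X_ultrametric p q (f p).
  rewrite (Heq p q)// leNgt => /negP; apply.
  by rewrite gt_max metric_sym fpr fpq.
have /card_eqPle[_ HfH] := inj_card_eq finj.
apply: card_le_trans HfH _; apply: subset_card_le => _ [p Hp <-].
by have [] := fP p Hp.
Qed.

(** * Extending partial isometries into an avoidant space *)

Section Extension.
Context {kappa : set nat} {Z : metricType K}.
Hypotheses (X_nonempty : [set: X] !=set0) (X_avoidant : avoidant R kappa X).
Hypotheses (Z_ultrametric : ultrametric Z) (Z_valued : valued R Z).
Hypotheses (Z_finite : finite_set [set: Z]) (Z_card : [set: Z] #<= kappa).

(** A partial isometry is a total map whose values off [S] are arbitrary. *)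
Let isometric_on (S : set Z) (g : Z -> X) :=
  forall x y, S x -> S y -> mdist (g x) (g y) = mdist x y.

(* With z0 a point of S closest to z, an image of z needs only to be at distance
   r = mdist z z0 from the part of g @` S lying in the ball B(g z0, r): the
   distances to the rest of g @` S are then forced by the isosceles property. *)
Lemma one_point_extension S g z : isometric_on S g ->
  exists p, forall y, S y -> mdist (g y) p = mdist y z.
Proof.
move=> giso; have [Sz|NSz] := pselect (S z).
  by exists (g z) => y Sy; exact: giso.
have Sfin : finite_set S by exact: sub_finite_set Z_finite.
have [[//|x s] SE] := (finite_seqP S).1 Sfin.
  by case: X_nonempty => p _; exists p; rewrite SE.
have [z0 z0s z0min] := seq_argmin (mdist z) x s.
have Sz0 : S z0 by rewrite SE.
pose r := mdist z z0.
have Rr : (R `\ 0) r.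
  split; first exact: Z_valued.
  by move=> /mdist_positivity zz0; apply: NSz; rewrite zz0.
pose A := g @` S `&` cball (g z0) r.
(* [S] misses [z], so it is strictly smaller than the finite [Z]; hence [Z] itself may have
   cardinality [kappa]. *)
have Ak : card_lt A kappa.
  have Sk : card_lt S kappa.
    by apply: (card_lt_proper Z_finite) => //; split=> // /(_ z I).
  have AS : A #<= S.
    by apply: card_le_trans (card_image_le g S); apply: subset_card_le => ? [].
  split; first exact: card_le_trans AS Sk.1.
  apply/negP => /card_eqPle[_ kA]; have [Sk1 /negP] := Sk; apply.
  by apply/card_eqPle; split=> //; exact: card_le_trans kA AS.
have [p [pball pA]] := X_avoidant Rr (@subIsetr _ _ _) Ak.
exists p => y Sy.
have zy : r <= mdist z y by apply: z0min; rewrite SE in Sy.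
(* If [y] is within [r] of [z0], then [mdist y z] is exactly [r]: at least [r] by minimality of
   [z0], at most [r] by the ultrametric inequality. *)
have [yz0|yz0] := leP (mdist z0 y) r.
  rewrite pA; last by split; [exists y|rewrite /cball/= giso].
  apply/eqP; rewrite eq_le (metric_sym y z) zy/=.
  by rewrite (le_trans (Z_ultrametric _ _ z0))// ge_max lexx.
have isosceles (M : metricType K) (x0 u v : M) : ultrametric M ->
    mdist x0 v < mdist x0 u -> mdist u v = mdist x0 u.
  move=> uM vu; apply/eqP; rewrite eq_le.
  have := uM x0 u v; rewrite le_max (leNgt (mdist x0 u)) vu/= (metric_sym v) => ->.
  by rewrite (le_trans (uM _ _ x0))// ge_max (metric_sym u) lexx ltW.
(* Both sides equal [mdist z0 y]: it exceeds [r], while [p] and [z] are within [r] of [g z0] and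
   [z0]. *)
rewrite (isosceles _ (g z0))// giso//; last exact: le_lt_trans pball yz0.
by rewrite (isosceles _ z0 y z)// (metric_sym z0 z).
Qed.

Lemma seq_extension (s : seq Z) S g : isometric_on S g ->
  exists h, isometric_on (S `|` [set` s]) h /\ {in S, h =1 g}.
Proof.
elim: s S g => [|z s IHs] S g giso.
  by exists g; split=> //; rewrite set_nil setU0.
have [p pP] := one_point_extension z giso.
(* If [z] already lies in [S], the old value [g z] is kept and [p] is discarded. *)
pose g' y := if pselect (S y) then g y else p.
have g'S y : S y -> g' y = g y by rewrite /g'; case: pselect.
have g'P y : S y -> mdist (g' y) (g' z) = mdist y z.
  move=> Sy; rewrite (g'S y Sy) /g'; case: pselect => [Sz|NSz] /=; last exact: pP.
  exact: giso.
have g'iso : isometric_on (S `|` [set z]) g'.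
  move=> x y [Sx|->] [Sy|->].
  - by rewrite !g'S//; exact: giso.
  - exact: g'P.
  - by rewrite metric_sym g'P// metric_sym.
  - by rewrite !mdistxx.
have [h [hiso hg']] := IHs _ _ g'iso; exists h; split.
  have sub : S `|` [set` z :: s] `<=` (S `|` [set z]) `|` [set` s].
    by move=> y [Sy|/= /[1!inE]/predU1P[->|ys]]; [left; left|left; right|right].
  by move=> x y /sub Sx /sub Sy; exact: hiso.
by move=> y /set_mem Sy; rewrite hg' ?g'S//; apply: mem_set; left.
Qed.

Lemma isometric_extension (Y : metricType K) (phi : Y -> Z) (f : Y -> X) :
  isometric phi -> isometric f -> exists F : Z -> X, isometric F /\ F \o phi = f.
Proof.
move=> phi_iso f_iso.
have [x0 _] := X_nonempty.
(* [f] factors through [phi], since points with equal images under [phi] are at distance 0; [x0] is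
   the default off the range. *)
have lift z : exists x, forall y, phi y = z -> f y = x.
  have [[y _ <-]|Nz] := pselect (range phi z).
    exists (f y) => y' phiy'; apply: mdist_positivity.
    by rewrite f_iso -phi_iso phiy' mdistxx.
  by exists x0 => y yz; case: Nz; exists y.
have [g gP] := choice lift.
have giso : isometric_on (range phi) g.
  move=> _ _ [y _ <-] [y' _ <-].
  by rewrite -(gP _ y)// -(gP _ y')// f_iso phi_iso.
have [s sE] := (finite_seqP _).1 Z_finite.
have [F [Fiso Fg]] := seq_extension s giso.
exists F; split.
  by move=> x y; apply: Fiso; right; rewrite -sE.
apply/funext => y /=; rewrite Fg; last by apply: mem_set; exists y.
exact/esym/gP.
Qed.

End Extension.

(** Two cardinals are kept because the finite case shifts by one, [I_n] against [I_n.+1], while for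
    omega_0 both are [[set: nat]]. *)
Lemma avoidant_injective (kappa kappa' : set nat) :
  [set: X] !=set0 ->
  (forall T (A : set T), card_lt A kappa' -> A #<= kappa) ->
  avoidant R kappa X -> injective_for (valued_ultrametric_class R kappa') X.
Proof.
move=> X0 kk' Xav; split=> // Y Z _ [Zu Zv Zk] phi f.
exact: (isometric_extension X0 Xav Zu Zv (card_lt_finite Zk) (kk' _ _ Zk)).
Qed.

(** * Avoidance of all finite sets and infinite halos *)

Lemma avoidant_nat :
  (forall n, (1 <= n)%N -> avoidant R `I_n X) -> avoidant R [set: nat] X.
Proof.
move=> Xav a r Rr A Aball /card_lt_finite[m /card_eqPle[Am _]].
(* Avoidance is strict in the cardinal, so a set of [m] points needs level [m.+1]. *)
by apply: (Xav m.+1 isT _ _ Rr _ Aball); apply/card_ltSn.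
Qed.

Lemma avoidant_haloed_nat :
  avoidant R [set: nat] X -> haloed R [set: nat] X.
Proof.
move=> Xav a r Rr.
have next (s : seq X) : exists p, [set` s] `<=` cball a r ->
    cball a r p /\ forall x, x \in s -> mdist x p = r.
  have [sball|Nsball] := pselect ([set` s] `<=` cball a r); last by exists a.
  have [] := Xav _ _ Rr _ sball; first exact/card_lt_nat/finite_seq.
  by move=> p pP; exists p.
have [p pP] := choice next.
(* [s n] lists the first [n] chosen points, the latest first; [p (s n)] is the next one. *)
pose s := fix s n := if n is m.+1 then p (s m) :: s m else [::].
have sball n : [set` s n] `<=` cball a r.
  elim: n => [//|n IHn] x /= /[1!inE]/predU1P[->|]; last exact: IHn.
  by have [] := pP (s n) IHn.
have smem m n : (m < n)%N -> p (s m) \in s n.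
  elim: n => // n IHn; rewrite ltnS leq_eqVlt in_cons => /predU1P[->|/IHn ->].
    by rewrite eqxx.
  by rewrite orbT.
have dist_lt m n : (m < n)%N -> mdist (p (s m)) (p (s n)) = r.
  by move=> mn; have [_] := pP (s n) (sball n); apply; exact: smem.
have dist m n : m <> n -> mdist (p (s m)) (p (s n)) = r.
  move=> /eqP; rewrite neq_ltn => /orP[/dist_lt//|nm].
  by rewrite metric_sym dist_lt.
exists (range (p \o s)); split.
- by move=> _ [n _ <-]; have [] := pP (s n) (sball n).
- move=> _ _ [m _ <-] [n _ <-] mn; apply: dist => mnE.
  by apply: mn; rewrite mnE.
- suff /card_eqPle[_] : range (p \o s) #= [set: nat] by [].
  apply: inj_card_eq => m n _ _ /= pmn; apply: contrapT => /dist.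
  by rewrite pmn mdistxx => r0; have := range_gt0 Rr; rewrite -r0 ltxx.
Qed.

End Space.

Lemma injective_for_sub (C D : metricType K -> Prop) X :
  (forall Y, C Y -> D Y) -> injective_for D X -> injective_for C X.
Proof.
by move=> CD [X0 Xinj]; split=> // Y Z /CD DY /CD DZ; exact: Xinj.
Qed.

End UltrametricInjectivity.

(** Keeping [r] in the type lets the metric instance depend on it, and [posnum] carries its
    positivity. *)
Definition simplex {K : realType} (r : {posnum K}) (n : nat) : Type := 'I_n.

Section Simplex.
Context {K : realType} (r : {posnum K}) (n : nat).
Implicit Types i j k : simplex r n.

HB.instance Definition _ := Choice.on (simplex r n).

Let dist i j : K := if i == j then 0 else r%:num.

(** When [i] and [j] differ, [k] differs from one of them, so the maximum is [r]. *)
Let dist_ultra i j k : dist i j <= Num.max (dist i k) (dist k j).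
Proof.
rewrite /dist le_max; have [_|ij] := eqVneq i j; first by case: ifP => _; rewrite ?lexx ?ge0.
have [<-|_] := eqVneq i k; last by rewrite lexx.
by rewrite (negPf ij) lexx orbT.
Qed.

Let dist_ge0 i j : 0 <= dist i j.
Proof. by rewrite /dist; case: ifP. Qed.

Let distxx i : dist i i = 0.
Proof. by rewrite /dist eqxx. Qed.

Let dist_positivity i j : dist i j = 0 -> i = j.
Proof.
by rewrite /dist; case: eqP => // _ /eqP; rewrite gt_eqF.
Qed.

Let dist_sym i j : dist i j = dist j i.
Proof. by rewrite /dist eq_sym. Qed.

Let dist_triangle j i k : dist i k <= dist i j + dist j k.
Proof.
by rewrite (le_trans (dist_ultra i k j))// ge_max lerDl lerDr !dist_ge0.
Qed.

HB.instance Definition _ := isMetric.Build K (simplex r n)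
  distxx dist_positivity dist_sym dist_triangle.

Lemma simplexE i j : mdist i j = if i == j then 0 else r%:num.
Proof. by []. Qed.

Lemma simplex_ultrametric : ultrametric (simplex r n).
Proof. exact: dist_ultra. Qed.

Lemma simplex_class (R : set K) (m : nat) : R 0 -> R r%:num -> (n <= m)%N ->
  valued_ultrametric_class R `I_m.+1 (simplex r n).
Proof.
move=> R0 Rr nm; split; first exact: simplex_ultrametric.
  by move=> i j; rewrite simplexE; case: ifP.
by apply/card_ltSn; rewrite -(card_le_eql card_II) card_le_II.
Qed.

End Simplex.

(** * Injective spaces are haloed *)

Lemma injective_haloed (K : realType) (R : set K) (hR : range_set R)
    (X : metricType K) n : (1 <= n)%N ->
  injective_for (valued_ultrametric_class R `I_n.+1) X -> haloed R `I_n X.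
Proof.
case: n => // n _ [_ Xinj] a r Rr.
pose q := PosNum (range_gt0 hR Rr).
have cls m : (m <= n.+1)%N -> valued_ultrametric_class R `I_n.+2 (simplex q m).
  by move=> mn; apply: simplex_class => //; [exact: hR.2|exact: Rr.1].
(* Maps out of the one-point space are isometric for free. Sending the vertex [ord0] to [a] puts the
   range of [F] inside the ball around [a]. *)
have pt_iso (Y : metricType K) (f : simplex q 1 -> Y) : isometric f.
  by move=> i j; rewrite (ord1 i) (ord1 j) !mdistxx.
have [F [Fiso Fa]] := Xinj _ _ (cls 1 isT) (cls n.+1 (leqnn _)) _ _
  (pt_iso (simplex q n.+1) (fun=> ord0)) (pt_iso X (fun=> a)).
have {}Fa : F ord0 = a by have /(congr1 (@^~ ord0)) := Fa.
exists (range F); split.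
- move=> _ [i _ <-]; rewrite /cball/= -Fa Fiso simplexE.
  by case: ifP => // _; exact: ltW (range_gt0 hR Rr).
- move=> _ _ [i _ <-] [j _ <-] Fij; rewrite Fiso simplexE.
  by case: eqP => // ij; case: Fij; rewrite ij.
- rewrite (card_le_eql card_II).
  have Finj : {in [set: simplex q n.+1] &, injective F}.
    move=> i j _ _ Fij; apply: mdist_positivity.
    by rewrite -Fiso Fij mdistxx.
  by have /card_eqPle[] := inj_card_eq Finj.
Qed.

Theorem theorem1p1 (K : realType) (R : set K) (hR : range_set R)
    (X : metricType K) (X_nonempty : [set: X] !=set0)
    (X_ultrametric : ultrametric X) (X_valued : valued R X) :
  (forall n : nat, (1 <= n)%N ->
     [<-> haloed R `I_n X;
          avoidant R `I_n X;
          injective_for (valued_ultrametric_class R `I_n.+1) X]) /\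
  [<-> haloed R [set: nat] X;
       avoidant R [set: nat] X;
       injective_for (valued_ultrametric_class R [set: nat]) X].
Proof.
split=> [n n_gt0|]; tfae.
- exact: haloed_avoidant.
- by apply: avoidant_injective => // T A /card_ltSn.
- exact: injective_haloed.
- exact: haloed_avoidant.
- by apply: avoidant_injective => // T A [].
(* The finite equidistant sets found for different [n] need not be nested, hence the detour through
   avoidance. *)
- move=> Xinj; apply: avoidant_haloed_nat => //; apply: avoidant_nat => n n_gt0.
  apply: haloed_avoidant => //; apply: injective_haloed => //.
  apply: injective_for_sub Xinj => Y [Yu Yv /card_lt_finite Yfin].
  by split=> //; exact: card_lt_nat.
Qed.
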